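(* Let $g>0$ and $\omega>0$ be constants. Let $\eta\in C^1(\mathbb{R})$ with $\eta(x)>0$ for all $x\in\mathbb{R}$, let $D_\eta=\{(x,y)\in\mathbb{R}^2 : 0<y<\eta(x)\}$, and let $\psi\in C^2(\overline{D_\eta})$. Suppose that for some constants $m,Q\in\mathbb{R}$ the pair $(\psi,\eta)$ satisfies $$ \begin{aligned} \Delta\psi+\omega&=0 &&\text{in } D_\eta,\\ \tfrac12|\nabla\psi|^2+gy&=Q &&\text{on } y=\eta(x),\\ \psi&=m &&\text{on } y=\eta(x),\\ \psi&=0 &&\text{on } y=0,\\ \psi_y&>0 &&\text{everywhere in } \overline{D_\eta}. \end{aligned} $$ Then $$ \sup_{x\in\mathbb{R}}\eta(x)-\inf_{x\in\mathbb{R}}\eta(x)<2g\,\omega^{-2}. $$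
   Context: The system is the stream function formulation of the two-dimensional steady gravity water wave problem (without surface tension) over a flat bottom $y=0$, in a reference frame moving with the wave. Here $D_\eta$ is the fluid domain, $y=\eta(x)$ is the free surface profile, $\psi$ is the stream function, $\omega$ is the constant vorticity, $g$ is the gravitational constant, $m$ is the mass flux and $Q$ is the Bernoulli constant. The condition $\psi_y>0$ in $\overline{D_\eta}$ expresses that the flow is unidirectional. The notation ''on $y=\eta(x)$'' means at all points $(x,\eta(x))$, $x\in\mathbb{R}$, and ''on $y=0$'' means at all points $(x,0)$, $x\in\mathbb{R}$. No periodicity, symmetry or decay in $x$ is assumed. *)

(* Defs.v *)
From Stdlib Require Import Reals.
From Coquelicot Require Import Coquelicot.

Open Scope R_scope.

Definition closure (A : R * R -> Prop) (p : R * R) : Prop :=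
  forall V : R * R -> Prop, locally p V -> exists q, V q /\ A q.

Definition ex_dx (f : R * R -> R) (p : R * R) : Prop :=
  ex_derive (fun t => f (t, snd p)) (fst p).
Definition ex_dy (f : R * R -> R) (p : R * R) : Prop :=
  ex_derive (fun t => f (fst p, t)) (snd p).
Definition dx (f : R * R -> R) (p : R * R) : R :=
  Derive (fun t => f (t, snd p)) (fst p).
Definition dy (f : R * R -> R) (p : R * R) : R :=
  Derive (fun t => f (fst p, t)) (snd p).

Definition extends_to_closure (D : R * R -> Prop) (f : R * R -> R) : Prop :=
  exists F : R * R -> R,
    continuous_on (closure D) F /\ forall p, D p -> F p = f p.

Fixpoint derivs_extend (k : nat) (D : R * R -> Prop) (f : R * R -> R) : Prop :=
  extends_to_closure D f /\
  match k with
  | O => True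
  | S j =>
      (forall p, D p -> ex_dx f p /\ ex_dy f p) /\
      derivs_extend j D (dx f) /\ derivs_extend j D (dy f)
  end.

(* C^k up to the boundary of an open set D: f is continuous on the closure, and
   all its partial derivatives of order <= k exist in D and extend continuously
   to the closure.  No uniform bound is required.  Values of f outside the
   closure are irrelevant. *)
Definition Ck_closure (k : nat) (D : R * R -> Prop) (f : R * R -> R) : Prop :=
  continuous_on (closure D) f /\ derivs_extend k D f.

(* The value at p of the continuous extension of f from D, i.e. the limit of
   f q as q tends to p within D.  It gives meaning to partial derivatives at
   boundary points, where Derive would look outside the domain. *)
Definition ext (D : R * R -> Prop) (f : R * R -> R) (p : R * R) : R :=
  lim (filtermap f (within D (locally p))).

Definition fluid_domain (eta : R -> R) (p : R * R) : Prop :=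
  0 < snd p < eta (fst p).

Definition C1_line (f : R -> R) : Prop :=
  forall x, ex_derive f x /\ continuous (Derive f) x.

Definition values (f : R -> R) (y : R) : Prop := exists x, f x = y.

(* Main.v *)
(* Compare psi with the shear flows U(y) = a y - omega y^2 / 2.  The difference
   psi - U is harmonic, so it is controlled by its values on the bottom and on
   the surface.  Since psi_y > 0, comparison with the shear flow of flux m whose
   surface speed vanishes gives omega eta^2 <= 2 m.  Let r(d) = m / d - omega d / 2
   be the surface speed of the shear flow of flux m and depth d, and let
   i = inf eta, c = sup eta; thus r(c) >= 0.  Comparing psi with the shear flows
   of depths c and i, and differentiating at (almost) extremal surface points,
   gives 2 (Q - g c) <= r(c)^2 and r(i)^2 <= 2 (Q - g i), hence
   (r(i) - r(c)) (r(i) + r(c)) <= 2 g (c - i).  But r(i) - r(c) > omega (c - i)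
   if i < c, so omega (c - i) < r(i) - r(c) <= r(i) + r(c) < 2 g / omega. *)
Require Import Defs.
From Stdlib Require Import Reals Lra ClassicalEpsilon.
From Coquelicot Require Import Coquelicot.

Open Scope R_scope.

(** * Extrema of functions of one and two real variables *)

(** Maximise in [y] first, choosing a maximiser [s x] for each [x], then in [x]. The function [s]
    may jump, but the maximal value [F x (s x)] is continuous because [F] is uniformly continuous on
    a slightly wider rectangle. *)
Lemma rectangle_maximum (F : R -> R -> R) (a b c d : R) :
  a <= b -> c <= d ->
  (forall x y, continuity_2d_pt F x y) ->
  exists x0 y0, a <= x0 <= b /\ c <= y0 <= d /\
    forall x y, a <= x <= b -> c <= y <= d -> F x y <= F x0 y0.
Proof.
  intros Hab Hcd HF.
  assert (Hy : forall x, exists y, (forall v, c <= v <= d -> F x v <= F x y) /\ c <= y <= d).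
  { intros x. apply (continuity_ab_maj (F x)); [exact Hcd|].
    intros y _. apply continuity_pt_filterlim.
    apply filterlim_locally. intros eps.
    destruct (HF x y eps) as [del Hdel]. exists del. intros v Hv.
    apply Hdel; [|exact Hv].
    replace (x - x) with 0 by ring. rewrite Rabs_R0. apply cond_pos. }
  pose (s := fun x => proj1_sig (constructive_indefinite_description _ (Hy x))).
  assert (Hs : forall x, (forall v, c <= v <= d -> F x v <= F x (s x)) /\ c <= s x <= d).
  { intros x. unfold s.
    destruct (constructive_indefinite_description _ (Hy x)) as [y H]. exact H. }
  (* The margin 1 on both sides covers the neighbours [u] of an endpoint of [[a, b]]; hence
     [Rmin del 1] below. *)
  assert (Hunif := uniform_continuity_2d F (a - 1) (b + 1) c d (fun x y _ _ => HF x y)).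
  destruct (continuity_ab_maj (fun x => F x (s x)) a b Hab) as [x0 [H0 Hx0]].
  { intros x Hx. apply continuity_pt_filterlim, filterlim_locally. intros eps.
    destruct (Hunif eps) as [del Hdel].
    assert (Hm : 0 < Rmin del 1) by (apply Rmin_pos; [apply cond_pos | lra]).
    exists (mkposreal _ Hm). intros u Hu.
    change (Rabs (u - x) < Rmin del 1) in Hu.
    change (Rabs (F u (s u) - F x (s x)) < eps).
    assert (H1 := Rmin_l del 1). assert (H2 := Rmin_r del 1).
    apply Rabs_def2 in Hu.
    assert (Hclose : forall v, c <= v <= d -> Rabs (F u v - F x v) < eps).
    { intros v Hv. apply Hdel; try lra.
      - apply Rabs_def1; lra.
      - replace (v - v) with 0 by ring. rewrite Rabs_R0. apply cond_pos. }
    destruct (Hs u) as [Hu1 Hu2]. destruct (Hs x) as [Hxa Hxb].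
    assert (Ha := Hclose _ Hu2). assert (Hb := Hclose _ Hxb).
    apply Rabs_def2 in Ha. apply Rabs_def2 in Hb.
    specialize (Hu1 _ Hxb). specialize (Hxa _ Hu2).
    apply Rabs_def1; lra. }
  exists x0, (s x0). destruct (Hs x0) as [_ Hb]. repeat split; try apply Hx0; try apply Hb.
  intros x y Hx Hyy. destruct (Hs x) as [H1 _].
  eapply Rle_trans; [apply H1, Hyy|]. apply (H0 x Hx).
Qed.

(** If [l] were positive, [f'], which vanishes at the maximum, would be positive just to the right
    of [x], and the mean value theorem would push [f] above its maximum. *)
Lemma local_max_second_derivative (f f' : R -> R) (x l : R) :
  locally x (fun t => is_derive f t (f' t)) ->
  is_derive f' x l ->
  locally x (fun t => f t <= f x) ->
  l <= 0.
Proof.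
  intros [d1 Hd] Hl [d2 Hmax].
  destruct (Rle_or_lt l 0) as [|Hpos]; [assumption|exfalso].
  assert (H0 : f' x = 0).
  { assert (Hx : is_derive f x (f' x)) by (apply Hd, ball_center).
    apply is_derive_Reals in Hx.
    assert (Hm : 0 < d2) by apply cond_pos.
    set (pr := exist _ (f' x) Hx : derivable_pt f x).
    change (f' x) with (derive_pt f x pr).
    apply (deriv_maximum f (x - d2) (x + d2)); try lra.
    intros t Ht1 Ht2. apply Hmax. change (Rabs (t - x) < d2). apply Rabs_def1; lra. }
  apply is_derive_Reals in Hl.
  destruct (Hl (l / 2) ltac:(lra)) as [d3 Hd3].
  set (h := Rmin d1 (Rmin d2 d3) / 2).
  assert (A1 := Rmin_l d1 (Rmin d2 d3)). assert (A2 := Rmin_r d1 (Rmin d2 d3)).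
  assert (A3 := Rmin_l d2 d3). assert (A4 := Rmin_r d2 d3).
  assert (Hm : 0 < Rmin d1 (Rmin d2 d3)) by (repeat apply Rmin_pos; apply cond_pos).
  assert (Hder : forall t, x <= t <= x + h -> is_derive f t (f' t)).
  { intros t Ht. apply Hd. change (Rabs (t - x) < d1). unfold h in Ht.
    apply Rabs_def1; lra. }
  assert (Hinc : forall t, x < t <= x + h -> 0 < f' t).
  { intros t Ht. specialize (Hd3 (t - x) ltac:(lra)).
    rewrite H0 in Hd3. replace (x + (t - x)) with t in Hd3 by ring.
    assert (Hq : Rabs ((f' t - 0) / (t - x) - l) < l / 2).
    { apply Hd3. unfold h in Ht. apply Rabs_def1; lra. }
    apply Rabs_def2 in Hq.
    assert (0 < (f' t - 0) / (t - x)) by lra.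
    replace (f' t) with ((f' t - 0) / (t - x) * (t - x)) by (field; lra).
    apply Rmult_lt_0_compat; lra. }
  assert (Hh : 0 < h) by (unfold h; lra).
  assert (Hi : f x < f (x + h)).
  { destruct (MVT_cor2 f f' x (x + h)) as [c [Hc1 Hc2]]; [lra| |].
    - intros t Ht. apply is_derive_Reals, Hder, Ht.
    - assert (0 < f' c) by (apply Hinc; lra). nra. }
  assert (f (x + h) <= f x); [|lra].
  apply Hmax. change (Rabs (x + h - x) < d2). unfold h. apply Rabs_def1; lra.
Qed.

(** Version for a maximum at a boundary point: [f' 0] stands for the limit of the derivatives at
    positive [t]. If it were positive, [f] would increase just to the right of 0. *)
Lemma one_sided_max_derivative (f f' : R -> R) (t0 : R) :
  0 < t0 ->
  continuous f 0 -> continuous f' 0 ->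
  (forall t, 0 < t < t0 -> is_derive f t (f' t)) ->
  (forall t, 0 < t < t0 -> f t <= f 0) ->
  f' 0 <= 0.
Proof.
  intros Ht0 Hf Hf' Hder Hmax.
  destruct (Rle_or_lt (f' 0) 0) as [|Hpos]; [assumption|exfalso].
  destruct (proj1 (filterlim_locally _ _) Hf' (mkposreal _ Hpos)) as [d Hd].
  simpl in Hd.
  assert (Hdp := cond_pos d).
  assert (A1 := Rmin_l d t0). assert (A2 := Rmin_r d t0).
  assert (Hm : 0 < Rmin d t0) by (apply Rmin_pos; lra).
  set (h := Rmin d t0 / 2). assert (Hh : 0 < h) by (unfold h; lra).
  destruct (MVT_gen f 0 h f') as [c [Hc1 Hc2]].
  - intros t. rewrite Rmin_left, Rmax_right by lra. intros Ht. apply Hder.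
    unfold h in Ht. lra.
  - intros t. rewrite Rmin_left, Rmax_right by lra. intros Ht.
    apply continuity_pt_filterlim.
    destruct (Req_dec t 0) as [->|Hn]; [exact Hf|].
    apply (ex_derive_continuous f). exists (f' t). apply Hder. unfold h in Ht. lra.
  - rewrite Rmin_left, Rmax_right in Hc1 by lra.
    assert (Hc : 0 < f' c).
    { assert (Hb : ball (f' 0) (f' 0) (f' c)).
      { apply Hd. change (Rabs (c - 0) < d). unfold h in Hc1. apply Rabs_def1; lra. }
      change (Rabs (f' c - f' 0) < f' 0) in Hb. apply Rabs_def2 in Hb. lra. }
    assert (f h <= f 0) by (apply Hmax; unfold h; lra).
    nra.
Qed.

Lemma coercive_maximum (S : R -> R) (x1 : R) :
  (forall x, continuous S x) ->
  (exists X, 0 <= X /\ forall x, X < Rabs (x - x1) -> S x <= S x1) ->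
  exists x0, forall x, S x <= S x0.
Proof.
  intros Hc [X [HX Hfar]].
  destruct (continuity_ab_maj S (x1 - X) (x1 + X)) as [x0 [H0 Hx0]]; [lra| |].
  - intros x _. apply continuity_pt_filterlim, Hc.
  - exists x0. intros x.
    destruct (Rle_or_lt (Rabs (x - x1)) X) as [Hle|Hlt].
    + apply Rabs_le_between in Hle. apply H0; lra.
    + eapply Rle_trans; [apply Hfar, Hlt|]. apply H0; lra.
Qed.

(** * Flows with unidirectional velocity, extended to the plane *)

(** Here [psi], [px] and [py] are continuous on the whole plane, while [px] and [py] are tied to
    [psi] as derivatives only at interior points. Their values on the surface thus play the role of
    the boundary gradient. *)
Record flow (omega m : R) (eta : R -> R) (psi px py : R -> R -> R) : Prop := {
  flow_depth : forall x, 0 < eta x;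
  flow_surface_continuous : forall x, continuous eta x;
  flow_psi_continuous : forall x y, continuity_2d_pt psi x y;
  flow_px_continuous : forall x y, continuity_2d_pt px x y;
  flow_py_continuous : forall x y, continuity_2d_pt py x y;
  flow_px : forall x y, 0 < y < eta x -> is_derive (fun t => psi t y) x (px x y);
  flow_py : forall x y, 0 < y < eta x -> is_derive (fun t => psi x t) y (py x y);
  flow_laplacian : forall x y, 0 < y < eta x ->
    exists pxx pyy, is_derive (fun t => px t y) x pxx /\
      is_derive (fun t => py x t) y pyy /\ pxx + pyy + omega = 0;
  flow_bottom : forall x, psi x 0 = 0;
  flow_top : forall x, psi x (eta x) = m;
  flow_unidirectional : forall x y, 0 <= y <= eta x -> 0 < py x y }.

Arguments flow_depth {omega m eta psi px py}.
Arguments flow_surface_continuous {omega m eta psi px py}.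
Arguments flow_psi_continuous {omega m eta psi px py}.
Arguments flow_px_continuous {omega m eta psi px py}.
Arguments flow_py_continuous {omega m eta psi px py}.
Arguments flow_px {omega m eta psi px py}.
Arguments flow_py {omega m eta psi px py}.
Arguments flow_laplacian {omega m eta psi px py}.
Arguments flow_bottom {omega m eta psi px py}.
Arguments flow_top {omega m eta psi px py}.
Arguments flow_unidirectional {omega m eta psi px py}.

Lemma continuous_along (F : R -> R -> R) (u v : R -> R) (t : R) :
  (forall x y, continuity_2d_pt F x y) ->
  continuous u t -> continuous v t -> continuous (fun s => F (u s) (v s)) t.
Proof.
  intros HF Hu Hv. apply (continuous_comp_2 u v F); [exact Hu|exact Hv|].
  apply (proj1 (continuity_2d_pt_filterlim F (u t) (v t))), HF.
Qed.

Lemma flow_increasing {omega m : R} {eta : R -> R} {psi px py : R -> R -> R}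
    (Hflow : flow omega m eta psi px py) (x y1 y2 : R) :
  0 <= y1 -> y1 < y2 -> y2 <= eta x -> psi x y1 < psi x y2.
Proof.
  intros H1 H12 H2.
  destruct (MVT_gen (psi x) y1 y2 (py x)) as [c [Hc1 Hc2]].
  - intros t. rewrite Rmin_left, Rmax_right by lra. intros Ht.
    apply (flow_py Hflow). lra.
  - intros t _. apply continuity_pt_filterlim.
    apply (continuous_along psi (fun _ => x) (fun t => t)).
    + apply (flow_psi_continuous Hflow).
    + apply continuous_const.
    + apply continuous_id.
  - rewrite Rmin_left, Rmax_right in Hc1 by lra.
    assert (0 < py x c) by (apply (flow_unidirectional Hflow); lra).
    nra.
Qed.

Lemma flow_psi_bounds {omega m : R} {eta : R -> R} {psi px py : R -> R -> R}
    (Hflow : flow omega m eta psi px py) (x y : R) :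
  0 <= y <= eta x -> 0 <= psi x y <= m.
Proof.
  intros Hy.
  assert (Hb := flow_bottom Hflow x).
  assert (Ht := flow_top Hflow x).
  split.
  - destruct (Req_dec y 0) as [->|]; [lra|].
    assert (psi x 0 < psi x y) by (apply (flow_increasing Hflow); lra). lra.
  - destruct (Req_dec y (eta x)) as [->|]; [lra|].
    assert (psi x y < psi x (eta x)) by (apply (flow_increasing Hflow); lra). lra.
Qed.

Lemma flow_flux_pos {omega m : R} {eta : R -> R} {psi px py : R -> R -> R}
    (Hflow : flow omega m eta psi px py) : 0 < m.
Proof.
  rewrite <- (flow_bottom Hflow 0), <- (flow_top Hflow 0).
  assert (H := flow_depth Hflow 0).
  apply (flow_increasing Hflow); lra.
Qed.

(** * Comparison with shear flows by a maximum principle *)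

(** The stream function of the parallel flow of speed [a - omega * y], zero on the bottom; its
    Laplacian is [- omega], so its difference from [psi] is harmonic. *)
Definition shear (omega a y : R) : R := a * y - omega * y ^ 2 / 2.

(* A function with Laplacian -2, growing in x and nonnegative in the strip
   [0 <= y <= h]: it compensates for the lack of compactness. *)
Definition barrier (h x1 x y : R) : R := (x - x1) ^ 2 + 2 * (h ^ 2 - y ^ 2).

Lemma barrier_nonneg (h x1 x y : R) : 0 <= y <= h -> 0 <= barrier h x1 x y.
Proof.
  intros Hy. unfold barrier.
  assert (H1 := pow2_ge_0 (x - x1)).
  assert (H2 := pow_incr y h 2 Hy). lra.
Qed.

(* An upper bound on it compares psi from above ([s = 1]) or from below
   ([s = -1]) with a shear flow, up to the barrier. *)
Definition gap (omega : R) (psi : R -> R -> R) (s a e h x1 x y : R) : R :=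
  s * (psi x y - shear omega a y) - e * barrier h x1 x y.

Lemma gap_continuous (omega : R) (psi : R -> R -> R) (s a e h x1 x y : R) :
  continuity_2d_pt psi x y ->
  continuity_2d_pt (gap omega psi s a e h x1) x y.
Proof.
  intros Hpsi. apply continuity_2d_pt_minus.
  - apply continuity_2d_pt_mult; [apply continuity_2d_pt_const|].
    apply continuity_2d_pt_minus; [exact Hpsi|].
    apply continuity_2d_pt_filterlim.
    apply (continuous_comp (fun z : R * R => snd z) (shear omega a)).
    + apply continuous_snd.
    + apply (ex_derive_continuous (shear omega a)). unfold shear. auto_derive. trivial.
  - apply continuity_2d_pt_mult; [apply continuity_2d_pt_const|].
    apply continuity_2d_pt_plus.
    + apply continuity_2d_pt_filterlim.
      apply (continuous_comp (fun z : R * R => fst z) (fun u => (u - x1) ^ 2)).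
      * apply continuous_fst.
      * apply (ex_derive_continuous (fun u => (u - x1) ^ 2)). auto_derive. trivial.
    + apply continuity_2d_pt_filterlim.
      apply (continuous_comp (fun z : R * R => snd z) (fun v => 2 * (h ^ 2 - v ^ 2))).
      * apply continuous_snd.
      * apply (ex_derive_continuous (fun v => 2 * (h ^ 2 - v ^ 2))). auto_derive. trivial.
Qed.

(** Both [psi] and the shear flow are bounded in the strip. It matters that [C] does not depend on
    [e]: later [e] is chosen in terms of [C]. *)
Lemma gap_upper_bound (omega m : R) (eta : R -> R) (psi px py : R -> R -> R)
    (s a h x1 : R) :
  flow omega m eta psi px py ->
  0 < omega -> (forall x, eta x <= h) -> (s = 1 \/ s = -1) ->
  exists C, 0 < C /\ forall e x y, 0 < e -> 0 <= y <= eta x ->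
    gap omega psi s a e h x1 x y <= C - e * (x - x1) ^ 2.
Proof.
  intros Hf Hom Hh Hs.
  assert (Hm := flow_flux_pos Hf).
  assert (H0 : 0 < h) by (eapply Rlt_le_trans; [apply (flow_depth Hf 0) | apply Hh]).
  exists (m + Rabs a * h + omega * h ^ 2 / 2).
  assert (Ha := Rabs_pos a).
  assert (0 < omega * h ^ 2) by (apply Rmult_lt_0_compat; nra).
  split; [nra|].
  intros e x y He Hy. specialize (Hh x).
  assert (Hp := flow_psi_bounds Hf x y Hy).
  unfold gap, barrier, shear.
  assert (Hy2 : 0 <= y ^ 2 <= h ^ 2) by nra.
  assert (Hay : - (Rabs a * h) <= a * y <= Rabs a * h).
  { apply Rabs_le_between. rewrite Rabs_mult, (Rabs_pos_eq y) by lra.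
    apply Rmult_le_compat_l; lra. }
  assert (omega * y ^ 2 <= omega * h ^ 2) by nra.
  assert (0 <= omega * y ^ 2) by nra.
  assert (0 <= e * (2 * (h ^ 2 - y ^ 2))) by nra.
  destruct Hs as [-> | ->]; lra.
Qed.

(** Maximum principle: the gap has Laplacian [2 * e > 0], so it has no interior maximum; on the
    bottom it is minus the barrier term, and it tends to minus infinity along the strip. The shift
    [K] allows a bound by the maximum over the surface instead of by 0. *)
Lemma gap_nonpositive (omega m : R) (eta : R -> R) (psi px py : R -> R -> R)
    (s a e K h x1 : R) :
  flow omega m eta psi px py ->
  0 < omega -> (forall x, eta x <= h) -> (s = 1 \/ s = -1) -> 0 < e ->
  K <= 0 ->
  (forall x, gap omega psi s a e h x1 x (eta x) + K <= 0) ->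
  forall x y, 0 <= y <= eta x -> gap omega psi s a e h x1 x y + K <= 0.
Proof.
  intros Hf Hom Hh Hs He HK Htop x y Hy.
  destruct (Rle_or_lt (gap omega psi s a e h x1 x y + K) 0) as [|Hpos]; [assumption|exfalso].
  destruct (gap_upper_bound omega m eta psi px py s a h x1 Hf Hom Hh Hs) as [C [HC Hup]].
  (* A half-width for which [x] lies in the window and [C < e * X ^ 2], so that the gap is negative
     on the lateral sides. *)
  set (X := Rabs (x - x1) + 1 + C / e).
  assert (HX0 : 0 < C / e) by (apply Rdiv_lt_0_compat; assumption).
  assert (Hax := Rabs_pos (x - x1)).
  assert (HX : C < e * X ^ 2).
  { assert (H1 : 1 <= X) by (unfold X; lra).
    assert (H2 : C / e < X) by (unfold X; lra).
    assert (H3 : C < e * X).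
    { replace C with (e * (C / e)) by (field; lra). apply Rmult_lt_compat_l; assumption. }
    nra. }
  assert (HX1 : 1 <= X) by (unfold X; lra).
  (* The change of variable [y = t * eta u] turns the truncated fluid domain into a rectangle. *)
  destruct (rectangle_maximum (fun u t => gap omega psi s a e h x1 u (t * eta u))
              (x1 - X) (x1 + X) 0 1) as [x0 [t0 [Hx0 [Ht0 Hmax]]]]; try lra.
  { intros u t. apply continuity_2d_pt_filterlim.
    apply (continuous_comp_2 (fun z : R * R => fst z) (fun z : R * R => snd z * eta (fst z))
             (gap omega psi s a e h x1) (u, t)).
    - apply continuous_fst.
    - apply (continuous_mult (fun z : R * R => snd z) (fun z : R * R => eta (fst z))).
      + apply continuous_snd.
      + apply (continuous_comp (fun z : R * R => fst z) eta); [apply continuous_fst|].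
        apply (flow_surface_continuous Hf).
    - apply (proj1 (continuity_2d_pt_filterlim _ _ _)), gap_continuous,
        (flow_psi_continuous Hf). }
  set (y0 := t0 * eta x0).
  assert (Hd0 := flow_depth Hf).
  assert (Hmax' : forall u v, x1 - X <= u <= x1 + X -> 0 <= v <= eta u ->
            gap omega psi s a e h x1 u v <= gap omega psi s a e h x1 x0 y0).
  { intros u v Hu Hv. specialize (Hd0 u).
    replace v with (v / eta u * eta u) by (field; apply Rgt_not_eq; assumption).
    apply Hmax; [exact Hu|]. split.
    - apply Rdiv_le_0_compat; lra.
    - apply Rle_div_l; lra. }
  assert (Hval : 0 < gap omega psi s a e h x1 x0 y0 + K).
  { assert (Hxx : x1 - X <= x <= x1 + X).
    { assert (Hle : Rabs (x - x1) <= X) by (unfold X; lra).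
      apply Rabs_le_between in Hle. lra. }
    specialize (Hmax' x y Hxx Hy). lra. }
  assert (Hy0 : 0 <= y0 <= eta x0) by (specialize (Hd0 x0); unfold y0; nra).
  assert (Hx0' : x1 - X < x0 < x1 + X).
  { specialize (Hup e x0 y0 He Hy0).
    assert (e * (x0 - x1) ^ 2 < e * X ^ 2) by lra.
    assert ((x0 - x1) ^ 2 < X ^ 2) by (apply (Rmult_lt_reg_l e); assumption).
    split; nra. }
  assert (Hy0' : 0 < y0 < eta x0).
  { split.
    - destruct (Req_dec y0 0) as [Hz|]; [|lra]. exfalso.
      rewrite Hz in Hval. unfold gap, shear in Hval.
      rewrite (flow_bottom Hf) in Hval.
      assert (0 <= e * barrier h x1 x0 0).
      { apply Rmult_le_pos; [lra|]. apply barrier_nonneg.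
        specialize (Hd0 x0). specialize (Hh x0). lra. }
      replace (s * (0 - (a * 0 - omega * 0 ^ 2 / 2))) with 0 in Hval by field. lra.
    - destruct (Req_dec y0 (eta x0)) as [Hz|]; [|lra]. exfalso.
      rewrite Hz in Hval. specialize (Htop x0). lra. }
  destruct (flow_laplacian Hf x0 y0 Hy0') as [pxx [pyy [Hxx [Hyy Hlap]]]].
  assert (Hetac : locally x0 (fun t => y0 < eta t)).
  { apply (flow_surface_continuous Hf x0 (fun v => y0 < v)).
    apply (open_gt y0). lra. }
  (* The two second-derivative tests [H1] and [H2] add up, by the equation for the Laplacian, to
     [2 * e <= 0]. *)
  assert (H1 : s * pxx - 2 * e <= 0).
  { apply (local_max_second_derivative (fun t => gap omega psi s a e h x1 t y0)
             (fun t => s * px t y0 - e * (2 * (t - x1))) x0).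
    - generalize Hetac. apply filter_imp. intros t Ht.
      unfold gap, barrier. auto_derive.
      + exists (px t y0). apply (flow_px Hf). lra.
      + rewrite (is_derive_unique (fun u : R => psi u y0) t _ (flow_px Hf t y0 ltac:(lra))). ring.
    - auto_derive.
      + exists pxx. exact Hxx.
      + rewrite (is_derive_unique (fun u : R => px u y0) x0 _ Hxx). ring.
    - assert (Hlt : locally x0 (fun t => x1 - X < t < x1 + X)).
      { apply (open_and (fun t => x1 - X < t) (fun t => t < x1 + X)).
        apply open_gt. apply open_lt. exact Hx0'. }
      generalize (filter_and _ _ Hetac Hlt). apply filter_imp. intros t [Ht1 Ht2].
      apply Hmax'; lra. }
  assert (H2 : s * (pyy + omega) + 4 * e <= 0).
  { apply (local_max_second_derivative (fun t => gap omega psi s a e h x1 x0 t)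
             (fun t => s * (py x0 t - (a - omega * t)) + e * (4 * t)) y0).
    - assert (Hlt : locally y0 (fun t => 0 < t < eta x0)).
      { apply (open_and (fun t => 0 < t) (fun t => t < eta x0)).
        apply open_gt. apply open_lt. exact Hy0'. }
      revert Hlt. apply filter_imp. intros t Ht.
      unfold gap, barrier, shear. auto_derive.
      + exists (py x0 t). apply (flow_py Hf). lra.
      + rewrite (is_derive_unique (fun u : R => psi x0 u) t _ (flow_py Hf x0 t ltac:(lra))). field.
    - auto_derive.
      + exists pyy. exact Hyy.
      + rewrite (is_derive_unique (fun u : R => py x0 u) y0 _ Hyy). ring.
    - assert (Hlt : locally y0 (fun t => 0 < t < eta x0)).
      { apply (open_and (fun t => 0 < t) (fun t => t < eta x0)).
        apply open_gt. apply open_lt. exact Hy0'. }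
      revert Hlt. apply filter_imp. intros t Ht. apply Hmax'; lra. }
  assert (pxx = - omega - pyy) by lra. subst pxx. lra.
Qed.

(** The shear flow whose flux through depth [d] is [m] and whose speed vanishes there satisfies
    [shear <= m] at all heights. It therefore lies below [psi], which forces [psi = m] at height
    [d]; but [psi] is still less than [m] there if the surface is higher. *)
Lemma flow_depth_bound (omega m : R) (eta : R -> R) (psi px py : R -> R -> R) (h : R) :
  flow omega m eta psi px py ->
  0 < omega -> (forall x, eta x <= h) ->
  forall x, omega * eta x ^ 2 <= 2 * m.
Proof.
  intros Hf Hom Hh x1.
  destruct (Rle_or_lt (omega * eta x1 ^ 2) (2 * m)) as [|Hlt]; [assumption|exfalso].
  assert (Hm := flow_flux_pos Hf).
  set (d := sqrt (2 * m / omega)).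
  assert (Hd2 : omega * d ^ 2 = 2 * m).
  { unfold d. rewrite <- Rsqr_pow2, Rsqr_sqrt; [field; lra|].
    apply Rdiv_le_0_compat; lra. }
  assert (Hd : 0 < d) by (apply sqrt_lt_R0, Rdiv_lt_0_compat; lra).
  assert (Heta := flow_depth Hf x1).
  assert (Hde : d < eta x1).
  { assert (d ^ 2 < eta x1 ^ 2) by (apply (Rmult_lt_reg_l omega); lra). nra. }
  assert (Hpsi : psi x1 d < m).
  { rewrite <- (flow_top Hf x1). apply (flow_increasing Hf); lra. }
  assert (H0 : 0 < h) by (specialize (Hh x1); lra).
  assert (Hh2 : 0 < h ^ 2) by nra.
  (* Small enough for the barrier term at [(x1, d)], which is below [2 * e * h ^ 2], to use up less
     than half of the deficit [m - psi x1 d]. *)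
  set (e := (m - psi x1 d) / (4 * h ^ 2)).
  assert (He : 0 < e) by (apply Rdiv_lt_0_compat; lra).
  assert (Heh : 4 * (e * h ^ 2) = m - psi x1 d) by (unfold e; field; lra).
  assert (Hcmp : gap omega psi (-1) (omega * d) e h x1 x1 d + 0 <= 0).
  { apply (gap_nonpositive omega m eta psi px py); try assumption; try lra.
    intros x. unfold gap, shear. rewrite (flow_top Hf).
    assert (Hex := flow_depth Hf x). specialize (Hh x).
    assert (0 <= e * barrier h x1 x (eta x))
      by (apply Rmult_le_pos; [lra|apply barrier_nonneg; lra]).
    assert (0 <= omega * (eta x - d) ^ 2) by (apply Rmult_le_pos; [lra|apply pow2_ge_0]).
    lra. }
  unfold gap, shear, barrier in Hcmp.
  assert (0 < e * d ^ 2) by (apply Rmult_lt_0_compat; nra).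
  nra.
Qed.

(** An almost extremal surface point [x1] is replaced by a true maximum point [x0] of the gap. The
    loss in height and the gradient of the barrier at [x0] are both controlled by [delta], and the
    maximum over the surface is one over the fluid. *)
Lemma gap_touching (omega m : R) (eta : R -> R) (psi px py : R -> R -> R)
    (s a h x1 delta : R) :
  flow omega m eta psi px py ->
  0 < omega -> (forall x, eta x <= h) -> (s = 1 \/ s = -1) ->
  0 < s * (m - shear omega a (eta x1)) -> 0 < delta ->
  exists e x0, 0 < e <= delta /\ (e * (x0 - x1)) ^ 2 <= delta /\
    s * (m - shear omega a (eta x1)) - delta <= s * (m - shear omega a (eta x0)) /\
    forall x y, 0 <= y <= eta x ->
      gap omega psi s a e h x1 x y <= gap omega psi s a e h x1 x0 (eta x0).
Proof.
  intros Hf Hom Hh Hs Hv Hdel.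
  destruct (gap_upper_bound omega m eta psi px py s a h x1 Hf Hom Hh Hs) as [C [HC Hup]].
  assert (Hsurf : forall e x, gap omega psi s a e h x1 x (eta x)
            = s * (m - shear omega a (eta x)) - e * barrier h x1 x (eta x)).
  { intros e x. unfold gap. rewrite (flow_top Hf). reflexivity. }
  assert (Hd0 := flow_depth Hf).
  assert (Hbar : forall x, 0 <= barrier h x1 x (eta x)).
  { intros x. apply barrier_nonneg. specialize (Hh x). specialize (Hd0 x). lra. }
  assert (Hbar1 : barrier h x1 x1 (eta x1) <= 2 * h ^ 2).
  { unfold barrier. specialize (Hd0 x1). nra. }
  set (v := s * (m - shear omega a (eta x1))) in *.
  (* The bound [mu <= v] keeps the surface maximum nonnegative, as the maximum principle requires.
     With [e * N = mu], both [e * C] and [e * (2 * h ^ 2)] are at most [mu], and [mu <= 1] then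
     gives [e * (e * C) <= mu]. *)
  set (mu := Rmin 1 (Rmin delta v)).
  assert (Hmu : 0 < mu) by (repeat apply Rmin_pos; lra).
  assert (M1 : mu <= 1) by apply Rmin_l.
  assert (M2 : mu <= delta) by (eapply Rle_trans; [apply Rmin_r|apply Rmin_l]).
  assert (M3 : mu <= v) by (eapply Rle_trans; [apply Rmin_r|apply Rmin_r]).
  assert (Hh2 := pow2_ge_0 h).
  set (N := 1 + C + 2 * h ^ 2).
  assert (HN : 1 < N) by (unfold N; lra).
  set (e := mu / N).
  assert (He : 0 < e) by (apply Rdiv_lt_0_compat; lra).
  assert (HeN : e * N = mu) by (unfold e; field; lra).
  assert (He2 : e * (2 * h ^ 2) <= mu) by (unfold N in HeN; nra).
  assert (Hemu : e <= mu) by nra.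
  assert (H1 : v - mu <= gap omega psi s a e h x1 x1 (eta x1)).
  { rewrite Hsurf. fold v.
    assert (e * barrier h x1 x1 (eta x1) <= e * (2 * h ^ 2)) by (apply Rmult_le_compat_l; lra).
    lra. }
  destruct (coercive_maximum (fun x => gap omega psi s a e h x1 x (eta x)) x1) as [x0 Hx0].
  - intros x. apply continuous_along.
    + intros. apply gap_continuous, (flow_psi_continuous Hf).
    + apply continuous_id.
    + apply (flow_surface_continuous Hf).
  - exists (1 + C / e).
    assert (HX0 : 0 < C / e) by (apply Rdiv_lt_0_compat; assumption).
    split; [lra|]. intros x Hx.
    specialize (Hup e x (eta x) He). specialize (Hd0 x).
    assert (Hy : 0 <= eta x <= eta x) by lra. specialize (Hup Hy).
    assert (C < e * (x - x1) ^ 2); [|lra].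
    rewrite <- pow2_abs.
    assert (C = e * (C / e)) by (field; lra).
    set (X := Rabs (x - x1)) in *.
    assert (C < e * X) by nra. nra.
  - exists e, x0.
    assert (H01 := Hx0 x1).
    assert (Hq : e * (x0 - x1) ^ 2 <= C).
    { assert (Hy : 0 <= eta x0 <= eta x0) by (specialize (Hd0 x0); lra).
      specialize (Hup e x0 (eta x0) He Hy). lra. }
    repeat split; try lra.
    + replace ((e * (x0 - x1)) ^ 2) with (e * (e * (x0 - x1) ^ 2)) by ring.
      assert (e * (e * (x0 - x1) ^ 2) <= e * C) by (apply Rmult_le_compat_l; lra).
      unfold N in HeN. nra.
    + rewrite (Hsurf e x0) in H01.
      assert (0 <= e * barrier h x1 x0 (eta x0)) by (apply Rmult_le_pos; [lra|apply Hbar]).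
      lra.
    + intros x y Hy.
      assert (gap omega psi s a e h x1 x y + - gap omega psi s a e h x1 x0 (eta x0) <= 0); [|lra].
      apply (gap_nonpositive omega m eta psi px py); try assumption.
      * lra.
      * intros u. specialize (Hx0 u). simpl in Hx0. lra.
Qed.

(** * First-order conditions at surface points *)

(** Continuity of [px] upgrades the two partial derivatives to a total derivative, to which the
    chain rule applies. *)
Lemma flow_directional_derivative (omega m : R) (eta : R -> R) (psi px py : R -> R -> R)
    (x y v1 v2 t : R) :
  flow omega m eta psi px py ->
  0 < y + t * v2 < eta (x + t * v1) ->
  is_derive (fun r => psi (x + r * v1) (y + r * v2)) t
    (px (x + t * v1) (y + t * v2) * v1 + py (x + t * v1) (y + t * v2) * v2).
Proof.
  intros Hf Hin. apply is_derive_Reals.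
  apply (derivable_pt_lim_comp_2d psi (fun r => x + r * v1) (fun r => y + r * v2)).
  - apply filterdiff_differentiable_pt_lim.
    set (X := x + t * v1) in *. set (Y := y + t * v2) in *.
    eapply filterdiff_ext_lin.
    + apply (is_derive_filterdiff psi X Y px (py X Y)).
      * assert (Hdom : locally (X, Y) (fun u : R * R => 0 < snd u /\ 0 < eta (fst u) - snd u)).
        { apply filter_and.
          - apply (continuous_snd X Y (fun v => 0 < v)).
            apply (open_gt 0). apply Hin.
          - assert (Hc : continuous (fun u : R * R => eta (fst u) - snd u) (X, Y)).
            { apply (continuous_minus (fun u : R * R => eta (fst u)) (fun u : R * R => snd u)).
              - apply (continuous_comp (fun u : R * R => fst u) eta); [apply continuous_fst|].
                apply (flow_surface_continuous Hf).
              - apply continuous_snd. }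
            apply (Hc (fun v => 0 < v)). apply (open_gt 0). simpl. lra. }
        generalize Hdom. apply filter_imp. intros [u w] Hu. simpl in *.
        apply (flow_px Hf). lra.
      * apply (flow_py Hf), Hin.
      * apply (proj1 (continuity_2d_pt_filterlim _ _ _)), (flow_px_continuous Hf).
    + intros [u w]. simpl. reflexivity.
  - apply is_derive_Reals. auto_derive; [trivial|ring].
  - apply is_derive_Reals. auto_derive; [trivial|ring].
Qed.

(** The height of the surface above the moving point starts at 0 with slope [l * v1 - v2 > 0]; the
    bottom is out of reach for short times. *)
Lemma inward_direction (eta : R -> R) (x l v1 v2 : R) :
  0 < eta x -> is_derive eta x l -> v2 < l * v1 ->
  exists t0, 0 < t0 /\ forall t, 0 < t < t0 -> 0 < eta x + t * v2 < eta (x + t * v1).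
Proof.
  intros Hpos Hl Hv.
  assert (Hder : derivable_pt_lim (fun t => eta (x + t * v1) - (eta x + t * v2)) 0 (l * v1 - v2)).
  { apply is_derive_Reals. auto_derive.
    - replace (x + 0 * v1) with x by ring. exists l. exact Hl.
    - replace (x + 0 * v1) with x by ring.
      rewrite (is_derive_unique (fun u : R => eta u) x l Hl). ring. }
  destruct (Hder (l * v1 - v2) ltac:(lra)) as [d Hd].
  assert (Hv2 := Rabs_pos v2).
  set (r := eta x / (Rabs v2 + 1)).
  assert (Hr : 0 < r) by (apply Rdiv_lt_0_compat; lra).
  assert (Hrv : r * (Rabs v2 + 1) = eta x) by (unfold r; field; lra).
  exists (Rmin d r). split; [apply Rmin_pos; [apply cond_pos|exact Hr]|].
  intros t Ht. assert (A1 := Rmin_l d r). assert (A2 := Rmin_r d r).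
  split.
  - assert (- (t * Rabs v2) <= t * v2).
    { rewrite <- Ropp_mult_distr_r_reverse. apply Rmult_le_compat_l; [lra|].
      assert (H := Rle_abs (- v2)). rewrite Rabs_Ropp in H. lra. }
    assert (t * (Rabs v2 + 1) < r * (Rabs v2 + 1)) by (apply Rmult_lt_compat_r; lra).
    lra.
  - specialize (Hd t ltac:(lra)).
    assert (Hb : Rabs t < d) by (rewrite Rabs_pos_eq; lra).
    specialize (Hd Hb). apply Rabs_def2 in Hd. destruct Hd as [_ Hd].
    rewrite !Rplus_0_l, !Rmult_0_l, !Rplus_0_r in Hd.
    set (q := eta (x + t * v1) - (eta x + t * v2)) in *.
    replace (eta x - eta x) with 0 in Hd by ring.
    assert (Hq : 0 < (q - 0) / t) by lra.
    assert (0 < q); [|unfold q in *; lra].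
    replace q with ((q - 0) / t * t) by (field; lra).
    apply Rmult_lt_0_compat; lra.
Qed.

(** Move from the surface point into the fluid along a segment and apply the one-sided test. The
    term [G] holds the explicit comparison functions along the segment; it is 0 when [psi] itself is
    studied. *)
Lemma surface_max_derivative (omega m : R) (eta : R -> R) (psi px py : R -> R -> R)
    (x l v1 v2 s : R) (G G' : R -> R) :
  flow omega m eta psi px py ->
  is_derive eta x l -> v2 < l * v1 ->
  (forall t, is_derive G t (G' t)) -> continuous G' 0 ->
  (forall t, 0 <= eta x + t * v2 <= eta (x + t * v1) ->
     s * psi (x + t * v1) (eta x + t * v2) + G t <= s * psi x (eta x) + G 0) ->
  s * (px x (eta x) * v1 + py x (eta x) * v2) + G' 0 <= 0.
Proof.
  intros Hf Hl Hv HG HG' Hmax.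
  destruct (inward_direction eta x l v1 v2 (flow_depth Hf x) Hl Hv) as [t0 [Ht0 Hin]].
  assert (Hlin : forall c w t, continuous (fun r : R => c + r * w) t).
  { intros c w t. apply (ex_derive_continuous (fun r : R => c + r * w)). auto_derive. trivial. }
  assert (H := one_sided_max_derivative
    (fun t => s * psi (x + t * v1) (eta x + t * v2) + G t)
    (fun t => s * (px (x + t * v1) (eta x + t * v2) * v1
                   + py (x + t * v1) (eta x + t * v2) * v2) + G' t) t0).
  simpl in H. rewrite !Rmult_0_l, !Rplus_0_r in H.
  apply H; clear H.
  - exact Ht0.
  - apply (continuous_plus (fun t => s * psi (x + t * v1) (eta x + t * v2)) G).
    + apply (continuous_mult (fun _ : R => s)); [apply continuous_const|].
      apply (continuous_along psi); [apply (flow_psi_continuous Hf)| |]; apply Hlin.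
    + apply (ex_derive_continuous G). exists (G' 0). apply HG.
  - apply (continuous_plus (fun t => s * (px (x + t * v1) (eta x + t * v2) * v1
                   + py (x + t * v1) (eta x + t * v2) * v2)) G'); [|exact HG'].
    apply (continuous_mult (fun _ : R => s)); [apply continuous_const|].
    apply (continuous_plus (fun t => px (x + t * v1) (eta x + t * v2) * v1)
             (fun t => py (x + t * v1) (eta x + t * v2) * v2)).
    + apply (continuous_mult (fun t => px (x + t * v1) (eta x + t * v2)) (fun _ : R => v1));
        [|apply continuous_const].
      apply (continuous_along px); [apply (flow_px_continuous Hf)| |]; apply Hlin.
    + apply (continuous_mult (fun t => py (x + t * v1) (eta x + t * v2)) (fun _ : R => v2));
        [|apply continuous_const].
      apply (continuous_along py); [apply (flow_py_continuous Hf)| |]; apply Hlin.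
  - intros t Ht.
    apply (is_derive_plus (fun t => s * psi (x + t * v1) (eta x + t * v2)) G t); [|apply HG].
    apply (is_derive_scal (fun t => psi (x + t * v1) (eta x + t * v2))).
    apply (flow_directional_derivative omega m eta); [exact Hf|]. apply Hin, Ht.
  - intros t Ht. specialize (Hin t Ht). specialize (Hmax t ltac:(lra)). lra.
Qed.

(* A vector making no acute angle with any direction in an open half-plane is
   a nonnegative multiple of its outward normal [(-l, 1)]. *)
Lemma outward_normal (l q1 q2 : R) :
  (forall v1 v2, v2 < l * v1 -> q1 * v1 + q2 * v2 <= 0) ->
  0 <= q2 /\ q1 = - l * q2.
Proof.
  intros H.
  assert (H2 : 0 <= q2) by (specialize (H 0 (-1) ltac:(lra)); lra).
  split; [exact H2|].
  (* The tangents [(1, l)] and [(-1, -l)] bound the open half-plane; they are reached as limits of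
     [(1, l - k)] and [(-1, -l - k)]. *)
  assert (Hk : forall r, (forall k, 0 < k -> r <= q2 * k) -> r <= 0).
  { intros r Hr. destruct (Rle_or_lt r 0) as [|Hpos]; [assumption|exfalso].
    specialize (Hr (r / (2 * (q2 + 1))) ltac:(apply Rdiv_lt_0_compat; lra)).
    assert (q2 * (r / (2 * (q2 + 1))) < r); [|lra].
    apply (Rmult_lt_reg_r (2 * (q2 + 1))); [lra|].
    field_simplify; [nra|lra]. }
  apply Rle_antisym.
  - assert (q1 + l * q2 <= 0); [|lra]. apply Hk. intros k Hpos.
    specialize (H 1 (l - k) ltac:(lra)). lra.
  - assert (- q1 - l * q2 <= 0); [|lra]. apply Hk. intros k Hpos.
    specialize (H (-1) (- l - k) ltac:(lra)). lra.
Qed.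

(** Since [psi <= m] in the fluid with equality on the surface, every surface point is a maximum of
    [psi], so the gradient there is normal. This replaces differentiating [psi] along the
    surface. *)
Lemma flow_surface_gradient (omega m : R) (eta : R -> R) (psi px py : R -> R -> R) (x l : R) :
  flow omega m eta psi px py -> is_derive eta x l ->
  px x (eta x) = - l * py x (eta x).
Proof.
  intros Hf Hl.
  apply (outward_normal l). intros v1 v2 Hv.
  assert (H := surface_max_derivative omega m eta psi px py x l v1 v2 1
                 (fun _ => 0) (fun _ => 0) Hf Hl Hv).
  enough (1 * (px x (eta x) * v1 + py x (eta x) * v2) + 0 <= 0) by lra. apply H.
  - intros t. apply (is_derive_const 0).
  - apply continuous_const.
  - intros t Ht. rewrite (flow_top Hf).
    assert (Hb := flow_psi_bounds Hf _ _ Ht). lra.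
Qed.

(** The two coefficients are the components of the gradient of the gap at the surface point. *)
Lemma gap_surface_max (omega m : R) (eta : R -> R) (psi px py : R -> R -> R)
    (s a e h x1 x l v1 v2 : R) :
  flow omega m eta psi px py -> is_derive eta x l -> v2 < l * v1 ->
  (forall u v, 0 <= v <= eta u ->
      gap omega psi s a e h x1 u v <= gap omega psi s a e h x1 x (eta x)) ->
  (s * px x (eta x) - 2 * e * (x - x1)) * v1
    + (s * (py x (eta x) - (a - omega * eta x)) + 4 * e * eta x) * v2 <= 0.
Proof.
  intros Hf Hl Hv Hmax.
  assert (H := surface_max_derivative omega m eta psi px py x l v1 v2 s
    (fun t => - s * shear omega a (eta x + t * v2)
              - e * barrier h x1 (x + t * v1) (eta x + t * v2))
    (fun t => - s * ((a - omega * (eta x + t * v2)) * v2)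
              - e * (2 * (x + t * v1 - x1) * v1 - 4 * (eta x + t * v2) * v2)) Hf Hl Hv).
  simpl in H. rewrite !Rmult_0_l, !Rplus_0_r in H.
  eapply Rle_trans; [|apply H].
  - apply Req_le. ring.
  - intros t. unfold shear, barrier. auto_derive; [trivial|field].
  - apply (ex_derive_continuous (fun t => - s * ((a - omega * (eta x + t * v2)) * v2)
              - e * (2 * (x + t * v1 - x1) * v1 - 4 * (eta x + t * v2) * v2))).
    auto_derive. trivial.
  - intros t Ht. specialize (Hmax _ _ Ht). unfold gap in Hmax. lra.
Qed.

(** * Bernoulli's law at the extremal heights, and the amplitude *)

Definition bernoulli (g Q : R) (eta : R -> R) (px py : R -> R -> R) : Prop :=
  forall x, / 2 * (px x (eta x) ^ 2 + py x (eta x) ^ 2) + g * eta x = Q.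

(** Turns estimates with an error linear in [d] into exact ones; [d <= 1] lets quadratic errors be
    absorbed in [M * d]. *)
Lemma nonpositive_of_small (x M : R) :
  (forall d, 0 < d <= 1 -> x <= M * d) -> x <= 0.
Proof.
  intros H. destruct (Rle_or_lt x 0) as [|Hx]; [assumption|exfalso].
  assert (HM : x <= M) by (specialize (H 1 ltac:(lra)); lra).
  assert (Hd : 0 < x / (2 * M) <= 1).
  { split; [apply Rdiv_lt_0_compat; lra|]. apply Rle_div_l; lra. }
  specialize (H _ Hd).
  replace (M * (x / (2 * M))) with (x / 2) in H by (field; lra). lra.
Qed.

Lemma shear_increment (omega a y z : R) :
  shear omega a z - shear omega a y = (z - y) * (a - omega * (z + y) / 2).
Proof. unfold shear. field. Qed.

(** A shear flow of flux slightly above [m] at depth [c] exceeds [psi] near the crest. Where the gap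
    is maximal, the gradients of [psi] and of the comparison function are both normal to the
    surface, so comparing vertical components bounds the whole speed by about [a - omega * c]. *)
Lemma bernoulli_at_supremum (g omega m Q : R) (eta : R -> R) (psi px py : R -> R -> R) (c a : R) :
  flow omega m eta psi px py -> 0 < g -> 0 < omega ->
  (forall x, ex_derive eta x) -> bernoulli g Q eta px py ->
  (forall x, eta x <= c) -> (forall d, 0 < d -> exists x, c - d < eta x) ->
  omega * c ^ 2 <= 2 * m -> m < shear omega a c ->
  2 * (Q - g * c) <= (a - omega * c) ^ 2.
Proof.
  intros Hf Hg Hom Heta HQ Hc Hsup Hd0 Ha.
  assert (Hpos := flow_depth Hf).
  assert (Hcpos : 0 < c) by (specialize (Hpos 0); specialize (Hc 0); lra).
  set (b := a - omega * c).
  assert (Hb : 0 < b).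
  { unfold shear in Ha. unfold b. apply (Rmult_lt_reg_r c); [assumption|]. lra. }
  assert (Hac : 0 < omega * c) by (apply Rmult_lt_0_compat; assumption).
  assert (Hapos : 0 < a) by (unfold b in Hb; lra).
  set (N := 2 * omega / b + 4 * c).
  assert (Hwb : 0 < 2 * omega / b) by (apply Rdiv_lt_0_compat; lra).
  assert (HN : 0 < N) by (unfold N; lra).
  enough (2 * (Q - g * c) - b ^ 2 <= 0) by lra.
  apply (nonpositive_of_small _ (2 * b * N + N ^ 2 + 4)).
  intros d [Hd Hd1].
  (* The second bound makes the gap datum at [x1] positive. As [shear] has slope at most [a] at
     positive heights, a height error below [k / a] costs less than [k]. *)
  set (k := Rmin d (shear omega a c - m)).
  assert (Hk : 0 < k) by (apply Rmin_pos; lra).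
  assert (K1 : k <= d) by apply Rmin_l.
  assert (K2 : k <= shear omega a c - m) by apply Rmin_r.
  destruct (Hsup (k / a)) as [x1 Hx1]; [apply Rdiv_lt_0_compat; lra|].
  assert (Hs1 : shear omega a c - shear omega a (eta x1) < k).
  { rewrite shear_increment.
    assert (H1 := Hc x1). assert (H2 := Hpos x1).
    assert (0 <= omega * (c + eta x1) / 2) by (apply Rmult_le_pos; [apply Rmult_le_pos|]; lra).
    apply Rle_lt_trans with ((c - eta x1) * a).
    - apply Rmult_le_compat_l; lra.
    - replace k with (k / a * a) by (field; lra). apply Rmult_lt_compat_r; lra. }
  destruct (gap_touching omega m eta psi px py (-1) a c x1 d) as
    [e [x0 [[He Hed] [Hex [Hs0 Hmax]]]]]; try assumption; try lra.
  assert (Hy := Hc x0). assert (Hy0 := Hpos x0).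
  destruct (Heta x0) as [l Hl].
  destruct (outward_normal l (-1 * px x0 (eta x0) - 2 * e * (x0 - x1))
     (-1 * (py x0 (eta x0) - (a - omega * eta x0)) + 4 * e * eta x0)) as [Hn1 Hn2].
  { intros v1 v2 Hv. apply (gap_surface_max omega m eta psi px py (-1) a e c x1 x0 l);
      assumption. }
  assert (Hgrad := flow_surface_gradient omega m eta psi px py x0 l Hf Hl).
  assert (Hpy : 0 < py x0 (eta x0)) by (apply (flow_unidirectional Hf); lra).
  specialize (HQ x0).
  set (P := px x0 (eta x0)) in *. set (T := py x0 (eta x0)) in *. set (y := eta x0) in *.
  (* Between [y] and [c] the shear flow has slope at least [b], so near-maximality of its value
     forces [y] close to [c]. *)
  assert (Hcy : b * (c - y) <= 2 * d).
  { assert (Hs2 : shear omega a c - shear omega a y <= 2 * d) by lra.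
    rewrite shear_increment in Hs2.
    apply Rle_trans with ((c - y) * (a - omega * (c + y) / 2)); [|assumption].
    rewrite Rmult_comm. apply Rmult_le_compat_l; [lra|].
    unfold b. assert (omega * y <= omega * c) by (apply Rmult_le_compat_l; lra). lra. }
  (* [W1] and [W2] form the gradient of the shear flow minus [e] times the barrier; [W1] is small
     and [W2] is close to [b]. *)
  set (W1 := - 2 * e * (x0 - x1)). set (W2 := a - omega * y + 4 * e * y).
  assert (HW2 : T <= W2) by (unfold W2; lra).
  assert (HW1 : W1 = - l * W2) by (unfold W1, W2; lra).
  assert (HW2' : W2 <= b + N * d).
  { assert (omega * (c - y) <= 2 * omega / b * d).
    { apply (Rmult_le_reg_r b); [assumption|].
      replace (2 * omega / b * d * b) with (omega * (2 * d)) by (field; lra).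
      replace (omega * (c - y) * b) with (omega * (b * (c - y))) by ring.
      apply Rmult_le_compat_l; lra. }
    assert (e * y <= d * c) by (apply Rmult_le_compat; lra).
    unfold W2, N, b in *. lra. }
  assert (HPT : P ^ 2 + T ^ 2 <= W1 ^ 2 + W2 ^ 2).
  { rewrite HW1, Hgrad.
    assert (T ^ 2 <= W2 ^ 2) by (apply pow_incr; lra).
    assert (0 <= l ^ 2) by apply pow2_ge_0.
    assert (l ^ 2 * T ^ 2 <= l ^ 2 * W2 ^ 2) by (apply Rmult_le_compat_l; assumption).
    lra. }
  assert (HW1' : W1 ^ 2 <= 4 * d).
  { unfold W1. replace ((-2 * e * (x0 - x1)) ^ 2) with (4 * (e * (x0 - x1)) ^ 2) by ring. lra. }
  assert (HW2q : W2 ^ 2 <= (b + N * d) ^ 2) by (apply pow_incr; lra).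
  assert (g * y <= g * c) by (apply Rmult_le_compat_l; lra).
  assert (N ^ 2 * d ^ 2 <= N ^ 2 * d).
  { apply Rmult_le_compat_l; [apply pow2_ge_0|].
    replace d with (d * 1) at 2 by ring. simpl. apply Rmult_le_compat_l; lra. }
  replace ((b + N * d) ^ 2) with (b ^ 2 + 2 * b * N * d + N ^ 2 * d ^ 2) in HW2q by ring.
  lra.
Qed.

(** Mirror argument with a shear flow of flux slightly below [m] at depth [i]. A lower bound on the
    speed follows from [py] alone, so testing the vertical direction is enough. The condition
    [omega * h < a] makes the shear flow increase up to height [h], so [y] must be close to [i]. *)
Lemma bernoulli_at_infimum (g omega m Q : R) (eta : R -> R) (psi px py : R -> R -> R) (i h a : R) :
  flow omega m eta psi px py -> 0 < g -> 0 < omega ->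
  (forall x, ex_derive eta x) -> bernoulli g Q eta px py ->
  (forall x, eta x <= h) ->
  0 <= i -> (forall x, i <= eta x) -> (forall d, 0 < d -> exists x, eta x < i + d) ->
  omega * h < a -> shear omega a i < m ->
  (a - omega * i) ^ 2 <= 2 * (Q - g * i).
Proof.
  intros Hf Hg Hom Heta HQ Hh Hi0 Hi Hinf Hah Ha.
  assert (Hpos := flow_depth Hf).
  assert (Hhpos : 0 < h) by (specialize (Hpos 0); specialize (Hh 0); lra).
  assert (Hih : i <= h) by (specialize (Hi 0); specialize (Hh 0); lra).
  set (b := a - omega * h). assert (Hb : 0 < b) by (unfold b; lra).
  assert (Hoh : 0 < omega * h) by (apply Rmult_lt_0_compat; assumption).
  assert (Hoi : omega * i <= omega * h) by (apply Rmult_le_compat_l; lra).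
  set (r := a - omega * i). assert (Hr : 0 < r) by (unfold r; lra).
  set (N := 2 * omega / b + 4 * h).
  assert (Hwb : 0 < 2 * omega / b) by (apply Rdiv_lt_0_compat; lra).
  assert (HN : 0 < N) by (unfold N; lra).
  enough (r ^ 2 - 2 * (Q - g * i) <= 0) by lra.
  apply (nonpositive_of_small _ (2 * r * N)).
  intros d [Hd Hd1].
  set (k := Rmin d (m - shear omega a i)).
  assert (Hk : 0 < k) by (apply Rmin_pos; lra).
  assert (K1 : k <= d) by apply Rmin_l.
  assert (K2 : k <= m - shear omega a i) by apply Rmin_r.
  destruct (Hinf (k / a)) as [x1 Hx1]; [apply Rdiv_lt_0_compat; lra|].
  assert (Hs1 : shear omega a (eta x1) - shear omega a i < k).
  { rewrite shear_increment.
    assert (H1 := Hi x1). assert (H2 := Hpos x1).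
    assert (0 <= omega * (eta x1 + i) / 2) by (apply Rmult_le_pos; [apply Rmult_le_pos|]; lra).
    apply Rle_lt_trans with ((eta x1 - i) * a).
    - apply Rmult_le_compat_l; lra.
    - replace k with (k / a * a) by (field; lra). apply Rmult_lt_compat_r; lra. }
  destruct (gap_touching omega m eta psi px py 1 a h x1 d) as
    [e [x0 [[He Hed] [Hex [Hs0 Hmax]]]]]; try assumption; try lra.
  assert (Hy := Hh x0). assert (Hyi := Hi x0). assert (Hy0 := Hpos x0).
  destruct (Heta x0) as [l Hl].
  assert (Hdown := gap_surface_max omega m eta psi px py 1 a e h x1 x0 l 0 (-1)
                     Hf Hl ltac:(lra) Hmax).
  specialize (HQ x0).
  set (P := px x0 (eta x0)) in *. set (T := py x0 (eta x0)) in *. set (y := eta x0) in *.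
  assert (Hyi2 : b * (y - i) <= 2 * d).
  { assert (Hs2 : shear omega a y - shear omega a i <= 2 * d) by lra.
    rewrite shear_increment in Hs2.
    apply Rle_trans with ((y - i) * (a - omega * (y + i) / 2)); [|assumption].
    rewrite Rmult_comm. apply Rmult_le_compat_l; [lra|].
    unfold b. assert (omega * y <= omega * h) by (apply Rmult_le_compat_l; lra). lra. }
  assert (HT : r - N * d <= T).
  { assert (omega * (y - i) <= 2 * omega / b * d).
    { apply (Rmult_le_reg_r b); [assumption|].
      replace (2 * omega / b * d * b) with (omega * (2 * d)) by (field; lra).
      replace (omega * (y - i) * b) with (omega * (b * (y - i))) by ring.
      apply Rmult_le_compat_l; lra. }
    assert (e * y <= d * h) by (apply Rmult_le_compat; lra).
    unfold N, r in *. lra. }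
  assert (g * i <= g * y) by (apply Rmult_le_compat_l; lra).
  assert (HT2 : T ^ 2 <= 2 * (Q - g * i)) by (assert (H1 := pow2_ge_0 P); lra).
  assert (H2 := pow2_ge_0 T).
  (* Squaring [HT] needs a nonnegative left side; otherwise [r < N * d] and [r ^ 2] is itself within
     the error. *)
  destruct (Rle_or_lt 0 (r - N * d)) as [Hc|Hc].
  - assert ((r - N * d) ^ 2 <= T ^ 2) by (apply pow_incr; lra).
    assert (H3 := pow2_ge_0 (N * d)).
    replace ((r - N * d) ^ 2) with (r ^ 2 - 2 * r * N * d + (N * d) ^ 2) in * by ring.
    lra.
  - assert (r * r < r * (N * d)) by (apply Rmult_lt_compat_l; lra).
    assert (0 < r * r) by (apply Rmult_lt_0_compat; assumption). lra.
Qed.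

Lemma amplitude_bound (g omega m Q : R) (eta : R -> R) (psi px py : R -> R -> R) (i c : R) :
  flow omega m eta psi px py -> 0 < g -> 0 < omega ->
  (forall x, ex_derive eta x) -> bernoulli g Q eta px py ->
  (forall x, i <= eta x <= c) -> 0 <= i ->
  (forall d, 0 < d -> exists x, eta x < i + d) ->
  (forall d, 0 < d -> exists x, c - d < eta x) ->
  c - i < 2 * g / omega ^ 2.
Proof.
  intros Hf Hg Hom Heta HQ Hic Hi0 Hinf Hsup.
  assert (Hc : forall x, eta x <= c) by apply Hic.
  assert (Hi : forall x, i <= eta x) by apply Hic.
  assert (Hcpos : 0 < c) by (assert (H := flow_depth Hf 0); specialize (Hc 0); lra).
  assert (Hm := flow_flux_pos Hf).
  assert (Hw2 : 0 < omega ^ 2) by (apply pow_lt; assumption).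
  destruct (Rle_or_lt c i) as [Hle|Hlt].
  { assert (0 < 2 * g / omega ^ 2) by (apply Rdiv_lt_0_compat; lra). lra. }
  assert (Hd0 : omega * c ^ 2 <= 2 * m).
  { destruct (Rle_or_lt (omega * c ^ 2) (2 * m)) as [|Hgt]; [assumption|exfalso].
    assert (Hbig : 0 < (omega * c ^ 2 - 2 * m) / (2 * omega * c)).
    { apply Rdiv_lt_0_compat; [lra|]. repeat apply Rmult_lt_0_compat; lra. }
    destruct (Hsup _ Hbig) as [x Hx].
    assert (Hb := flow_depth_bound omega m eta psi px py c Hf Hom Hc x).
    assert (He := flow_depth Hf x).
    set (q := (omega * c ^ 2 - 2 * m) / (2 * omega * c)) in *.
    assert (Hq : q * (2 * omega * c) = omega * c ^ 2 - 2 * m) by (unfold q; field; lra).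
    assert (0 < omega * c) by (apply Rmult_lt_0_compat; lra).
    assert ((c - eta x) * (omega * c) < q * (omega * c)) by (apply Rmult_lt_compat_r; lra).
    assert (0 <= omega * (c - eta x) ^ 2) by (apply Rmult_le_pos; [lra|apply pow2_ge_0]).
    nra. }
  (* At depth 0 every shear flow has flux [0 < m], so [i = 0] would give [a ^ 2 <= 2 * Q] for all
     large [a]. *)
  assert (Hipos : 0 < i).
  { destruct (Req_dec i 0) as [Hz|]; [exfalso|lra].
    set (a := omega * c + Rabs Q + 2).
    assert (HA := Rabs_pos Q). assert (HA2 := Rle_abs Q).
    assert (0 < omega * c) by (apply Rmult_lt_0_compat; lra).
    assert (Hinfb := bernoulli_at_infimum g omega m Q eta psi px py i c a Hf Hg Hom Heta HQ Hc
                   Hi0 Hi Hinf ltac:(unfold a; lra)).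
    rewrite Hz in Hinfb. unfold shear in Hinfb. specialize (Hinfb ltac:(lra)).
    assert (Ha : Rabs Q + 2 < a) by (unfold a; lra).
    nra. }
  (* Flux [m] through depth [d] means [a = m / d + omega * d / 2]; [r1] and [r2] are the resulting
     surface speeds [a - omega * d] for the depths [i] and [c]. *)
  set (r1 := m / i - omega * i / 2). set (r2 := m / c - omega * c / 2).
  assert (Hr2 : 0 <= r2).
  { unfold r2. apply (Rmult_le_reg_r c); [assumption|]. field_simplify; lra. }
  assert (Hdrop : omega * (c - i) < r1 - r2).
  { replace (r1 - r2) with ((c - i) * (m / (i * c) + omega / 2))
      by (unfold r1, r2; field; lra).
    rewrite Rmult_comm. apply Rmult_lt_compat_l; [lra|].
    assert (0 < i * c) by (apply Rmult_lt_0_compat; lra).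
    assert (omega / 2 < m / (i * c)); [|lra].
    apply (Rlt_div_r (omega / 2) m (i * c)); [lra|].
    assert (omega * (i * c) < omega * (c * c)).
    { apply Rmult_lt_compat_l; [assumption|]. apply Rmult_lt_compat_r; lra. }
    lra. }
  assert (Hsupb : 2 * (Q - g * c) <= r2 ^ 2).
  { enough (2 * (Q - g * c) - r2 ^ 2 <= 0) by lra.
    apply (nonpositive_of_small _ (2 * r2 + 1)). intros d [Hd Hd1].
    assert (H := bernoulli_at_supremum g omega m Q eta psi px py c (m / c + omega * c / 2 + d)
                   Hf Hg Hom Heta HQ Hc Hsup Hd0).
    replace (shear omega (m / c + omega * c / 2 + d) c) with (m + d * c) in H
      by (unfold shear; field; lra).
    assert (0 < d * c) by (apply Rmult_lt_0_compat; assumption).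
    specialize (H ltac:(lra)).
    replace (m / c + omega * c / 2 + d - omega * c) with (r2 + d) in H by (unfold r2; field; lra).
    nra. }
  assert (Hinfb : r1 ^ 2 <= 2 * (Q - g * i)).
  { enough (r1 ^ 2 - 2 * (Q - g * i) <= 0) by lra.
    (* The room between the exact parameter for depth [i] and [omega * c]. Lowering the parameter by
       [t * d / 2] makes the flux less than [m] yet keeps the parameter above [omega * c]. *)
    set (t := m / i + omega * i / 2 - omega * c).
    assert (Ht : 0 < t).
    { assert (0 < omega * (c - i)) by (apply Rmult_lt_0_compat; lra).
      assert (m / c <= m / i).
      { apply Rmult_le_compat_l; [lra|]. apply Rinv_le_contravar; lra. }
      unfold t, r1, r2 in *. lra. }
    apply (nonpositive_of_small _ (r1 * t)). intros d [Hd Hd1].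
    assert (Htd : 0 < t * d / 2) by (apply Rdiv_lt_0_compat; [apply Rmult_lt_0_compat|]; lra).
    assert (Htd' : t * d / 2 < t) by nra.
    assert (H := bernoulli_at_infimum g omega m Q eta psi px py i c
                   (m / i + omega * i / 2 - t * d / 2)
                   Hf Hg Hom Heta HQ Hc Hi0 Hi Hinf ltac:(unfold t in *; lra)).
    replace (shear omega (m / i + omega * i / 2 - t * d / 2) i) with (m - t * d / 2 * i) in H
      by (unfold shear; field; lra).
    assert (0 < t * d / 2 * i) by (apply Rmult_lt_0_compat; assumption).
    specialize (H ltac:(lra)).
    replace (m / i + omega * i / 2 - t * d / 2 - omega * i) with (r1 - t * d / 2) in H
      by (unfold r1; field; lra).
    assert (H1 := pow2_ge_0 (t * d / 2)). nra. }
  assert (Hwa : 0 < omega * (c - i)) by (apply Rmult_lt_0_compat; lra).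
  assert (Hdiff : (r1 - r2) * (r1 + r2) <= 2 * g * (c - i)) by nra.
  assert (Hsq : (omega * (c - i)) ^ 2 < 2 * g * (c - i)) by nra.
  apply Rlt_div_r; [lra|]. nra.
Qed.

(** * From the closed fluid domain to the plane *)

(* Precomposition with [clamp] extends functions from the closed fluid domain
   to the plane, so that two-sided continuity can be used at the boundary. *)
Definition clamp (eta : R -> R) (x y : R) : R := Rmax 0 (Rmin y (eta x)).

Lemma clamp_id (eta : R -> R) (x y : R) : 0 <= y <= eta x -> clamp eta x y = y.
Proof. intros Hy. unfold clamp. rewrite Rmin_left, Rmax_right; lra. Qed.

Lemma clamp_continuous (eta : R -> R) (x y : R) :
  continuous eta x -> continuity_2d_pt (clamp eta) x y.
Proof.
  intros Hc eps.
  destruct (proj1 (filterlim_locally _ _) Hc eps) as [d Hd].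
  assert (Hm : 0 < Rmin d eps) by (apply Rmin_pos; apply cond_pos).
  exists (mkposreal _ Hm). simpl. intros u v Hu Hv.
  assert (A1 := Rmin_l d eps). assert (A2 := Rmin_r d eps).
  assert (Hb : Rabs (eta u - eta x) < eps).
  { apply Hd. change (Rabs (u - x) < d). lra. }
  assert (Hv' : Rabs (v - y) < eps) by lra.
  apply Rabs_def2 in Hb. apply Rabs_def2 in Hv'. clear Hv Hu Hd Hm A1 A2.
  unfold clamp, Rmin.
  destruct (Rle_dec v (eta u)), (Rle_dec y (eta x)); unfold Rmax; apply Rabs_def1;
    repeat match goal with |- context [Rle_dec ?p ?q] => destruct (Rle_dec p q) end; lra.
Qed.

Lemma fluid_domain_closure (eta : R -> R) (x y : R) :
  0 < eta x -> 0 <= y <= eta x -> closure (fluid_domain eta) (x, y).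
Proof.
  intros He Hy V [eps Heps].
  assert (Hp := cond_pos eps).
  (* The point is moved by the fraction [t] of its way to mid-depth, which leads strictly inside and
     shifts it by less than [eps]. *)
  set (t := Rmin (1 / 2) (eps / (eta x + 1))).
  assert (Hr : 0 < eps / (eta x + 1)) by (apply Rdiv_lt_0_compat; lra).
  assert (Hrm : eps / (eta x + 1) * (eta x + 1) = eps) by (field; lra).
  assert (Ht : 0 < t) by (apply Rmin_pos; lra).
  assert (T1 : t <= 1 / 2) by apply Rmin_l.
  assert (T2 : t <= eps / (eta x + 1)) by apply Rmin_r.
  assert (Htm : t * (eta x + 1) <= eps).
  { rewrite <- Hrm. apply Rmult_le_compat_r; lra. }
  exists (x, y + t * (eta x / 2 - y)). split.
  - apply Heps. split; simpl.
    + apply ball_center.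
    + change (Rabs (y + t * (eta x / 2 - y) - y) < eps). apply Rabs_def1; nra.
  - unfold fluid_domain. simpl. split; nra.
Qed.

Lemma subset_closure (D : R * R -> Prop) (p : R * R) : D p -> closure D p.
Proof. intros Hp V HV. exists p. split; [apply locally_singleton, HV|exact Hp]. Qed.

(** The clamping map is a continuous retraction of the plane onto the closed domain, where [F] is
    continuous in the relative sense. *)
Lemma continuous_on_clamp (eta : R -> R) (F : R * R -> R) :
  (forall x, 0 < eta x) -> (forall x, continuous eta x) ->
  continuous_on (closure (fluid_domain eta)) F ->
  forall x y, continuity_2d_pt (fun u v => F (u, clamp eta u v)) x y.
Proof.
  intros Hpos Hc HF x y. apply continuity_2d_pt_filterlim.
  assert (Hcl : forall u v, closure (fluid_domain eta) (u, clamp eta u v)).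
  { intros u v. apply fluid_domain_closure; [apply Hpos|]. specialize (Hpos u).
    unfold clamp. split; [apply Rmax_l|].
    apply Rmax_lub; [lra|apply Rmin_r]. }
  apply (filterlim_comp _ _ _ (fun z : R * R => (fst z, clamp eta (fst z) (snd z))) F
           _ (within (closure (fluid_domain eta)) (locally (x, clamp eta x y)))).
  - intros P HP. unfold within in HP.
    assert (Hpair : filterlim (fun z : R * R => (fst z, clamp eta (fst z) (snd z)))
              (locally (x, y)) (locally (x, clamp eta x y))).
    { apply (continuous_comp_2 (fun z : R * R => fst z) (fun z : R * R => clamp eta (fst z) (snd z))
               (fun a b => (a, b)) (x, y)).
      - apply continuous_fst.
      - apply (proj1 (continuity_2d_pt_filterlim _ _ _)), clamp_continuous, Hc.
      - apply (continuous_ext (fun z : R * R => z)); [intros [a b]; reflexivity|].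
        apply continuous_id. }
    specialize (Hpair _ HP). unfold filtermap in *. revert Hpair.
    apply filter_imp. intros z Hz. apply Hz, Hcl.
  - apply HF, Hcl.
Qed.

(** Membership in the closure makes the filter of neighbourhoods within [D] proper, so limits along
    it are unique: [f] tends to [F p], and [lim] returns a limit because the image filter is
    Cauchy. *)
Lemma ext_eq (D : R * R -> Prop) (f F : R * R -> R) (p : R * R) :
  continuous_on (closure D) F -> (forall q, D q -> F q = f q) ->
  closure D p -> ext D f p = F p.
Proof.
  intros HF Hf Hp.
  assert (HP : ProperFilter (within D (locally p))).
  { constructor.
    - intros P HV. destruct (Hp _ HV) as [q [Hq1 Hq2]]. exists q. apply Hq1, Hq2.
    - apply within_filter, locally_filter. }
  assert (Hlim : filterlim f (within D (locally p)) (locally (F p))).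
  { intros P HPF. specialize (HF p Hp P HPF). unfold filtermap, within in *.
    revert HF. apply filter_imp. intros q Hq HD. rewrite <- (Hf q HD).
    apply Hq, subset_closure, HD. }
  apply (filterlim_locally_unique (V := R_NormedModule) (F := within D (locally p)) f); [|exact Hlim].
  apply filterlim_locally. intros eps.
  apply (complete_cauchy (T := R_CompleteSpace) (filtermap f (within D (locally p)))).
  - apply filtermap_proper_filter; exact HP.
  - intros e. exists (F p). apply Hlim. apply locally_ball.
Qed.

(** Near an interior point clamping is the identity along both coordinate lines, so the derivatives
    are those of [psi]. *)
Lemma fluid_domain_flow (omega m : R) (eta : R -> R) (psi Fx Fy : R * R -> R) :
  (forall x, 0 < eta x) -> (forall x, continuous eta x) ->
  Ck_closure 2 (fluid_domain eta) psi ->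
  continuous_on (closure (fluid_domain eta)) Fx ->
  (forall p, fluid_domain eta p -> Fx p = dx psi p) ->
  continuous_on (closure (fluid_domain eta)) Fy ->
  (forall p, fluid_domain eta p -> Fy p = dy psi p) ->
  (forall p, fluid_domain eta p -> dx (dx psi) p + dy (dy psi) p + omega = 0) ->
  (forall x, psi (x, eta x) = m) -> (forall x, psi (x, 0) = 0) ->
  (forall x y, 0 <= y <= eta x -> 0 < Fy (x, y)) ->
  flow omega m eta (fun x y => psi (x, clamp eta x y))
    (fun x y => Fx (x, clamp eta x y)) (fun x y => Fy (x, clamp eta x y)).
Proof.
  intros Hpos Hc [Hpsi [_ [Hd [[_ [Hdx _]] [_ [Hdy _]]]]]] HFx HFxe HFy HFye Hlap Htop Hbot Huni.
  assert (Hx : forall x y, 0 < y < eta x ->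
            locally x (fun t => 0 < y < eta t)).
  { intros x y Hy. apply filter_and; [apply filter_forall; intros; lra|].
    apply (Hc x (fun v => y < v)). apply (open_gt y). lra. }
  assert (Hyl : forall x y, 0 < y < eta x -> locally y (fun t => 0 < t < eta x)).
  { intros x y Hy. apply (open_and (fun t => 0 < t) (fun t => t < eta x));
      [apply open_gt|apply open_lt|exact Hy]. }
  constructor.
  - exact Hpos.
  - exact Hc.
  - apply continuous_on_clamp; assumption.
  - apply continuous_on_clamp; assumption.
  - apply continuous_on_clamp; assumption.
  - intros x y Hy. rewrite (clamp_id eta x y) by lra.
    apply (is_derive_ext_loc (fun t => psi (t, y))).
    + generalize (Hx x y Hy). apply filter_imp. intros t Ht. rewrite clamp_id by lra. reflexivity.
    + rewrite (HFxe (x, y) Hy).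
      apply (Derive_correct (fun t => psi (t, y))), (proj1 (Hd (x, y) Hy)).
  - intros x y Hy. rewrite (clamp_id eta x y) by lra.
    apply (is_derive_ext_loc (fun t => psi (x, t))).
    + generalize (Hyl x y Hy). apply filter_imp. intros t Ht. rewrite clamp_id by lra. reflexivity.
    + rewrite (HFye (x, y) Hy).
      apply (Derive_correct (fun t => psi (x, t))), (proj2 (Hd (x, y) Hy)).
  - intros x y Hy. exists (dx (dx psi) (x, y)), (dy (dy psi) (x, y)). split; [|split].
    + apply (is_derive_ext_loc (fun t => dx psi (t, y))).
      * generalize (Hx x y Hy). apply filter_imp. intros t Ht. rewrite clamp_id by lra.
        symmetry. apply HFxe. exact Ht.
      * apply (Derive_correct (fun t => dx psi (t, y))), (proj1 (Hdx (x, y) Hy)).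
    + apply (is_derive_ext_loc (fun t => dy psi (x, t))).
      * generalize (Hyl x y Hy). apply filter_imp. intros t Ht. rewrite clamp_id by lra.
        symmetry. apply HFye. exact Ht.
      * apply (Derive_correct (fun t => dy psi (x, t))), (proj2 (Hdy (x, y) Hy)).
    + apply Hlap. exact Hy.
  - intros x. rewrite clamp_id; [apply Hbot|]. specialize (Hpos x). lra.
  - intros x. rewrite clamp_id; [apply Htop|]. specialize (Hpos x). lra.
  - intros x y Hy. rewrite clamp_id by exact Hy. apply Huni, Hy.
Qed.

Lemma Lub_values (f : R -> R) (M : R) :
  (forall x, f x <= M) ->
  exists c, Lub_Rbar (values f) = Finite c /\ (forall x, f x <= c) /\
    forall d, 0 < d -> exists x, c - d < f x.
Proof.
  intros HM. destruct (Lub_Rbar_correct (values f)) as [Hub Hleast].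
  assert (H0 := Hub (f 0) (ex_intro _ 0 eq_refl)).
  assert (H1 : Rbar_le (Lub_Rbar (values f)) (Finite M)).
  { apply Hleast. intros y [x <-]. apply HM. }
  destruct (Lub_Rbar (values f)) as [c| |]; try contradiction.
  exists c. repeat split.
  - intros x. apply (Hub (f x)). exists x. reflexivity.
  - intros d Hd. apply NNPP. intros Hn.
    assert (H2 : Rbar_le (Finite c) (Finite (c - d))).
    { apply Hleast. intros y [x <-]. simpl. apply Rnot_lt_le. intros Hx. apply Hn. exists x. exact Hx. }
    simpl in H2. lra.
Qed.

Lemma Glb_values (f : R -> R) (M : R) :
  (forall x, M <= f x) ->
  exists i, Glb_Rbar (values f) = Finite i /\ M <= i /\ (forall x, i <= f x) /\
    forall d, 0 < d -> exists x, f x < i + d.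
Proof.
  intros HM. destruct (Glb_Rbar_correct (values f)) as [Hlb Hgreatest].
  assert (H0 := Hlb (f 0) (ex_intro _ 0 eq_refl)).
  assert (H1 : Rbar_le (Finite M) (Glb_Rbar (values f))).
  { apply Hgreatest. intros y [x <-]. apply HM. }
  destruct (Glb_Rbar (values f)) as [i| |]; try contradiction.
  exists i. repeat split.
  - exact H1.
  - intros x. apply (Hlb (f x)). exists x. reflexivity.
  - intros d Hd. apply NNPP. intros Hn.
    assert (H2 : Rbar_le (Finite (i + d)) (Finite i)).
    { apply Hgreatest. intros y [x <-]. simpl. apply Rnot_lt_le. intros Hx. apply Hn. exists x. exact Hx. }
    simpl in H2. lra.
Qed.

Theorem theorem2p1 :
  forall (g omega : R) (eta : R -> R) (psi : R * R -> R) (m Q : R),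
    0 < g ->
    0 < omega ->
    C1_line eta ->
    (forall x, 0 < eta x) ->
    Ck_closure 2 (fluid_domain eta) psi ->
    (forall p, fluid_domain eta p ->
       dx (dx psi) p + dy (dy psi) p + omega = 0) ->
    (forall x,
       / 2 * (ext (fluid_domain eta) (dx psi) (x, eta x) ^ 2 +
              ext (fluid_domain eta) (dy psi) (x, eta x) ^ 2)
         + g * eta x = Q) ->
    (forall x, psi (x, eta x) = m) ->
    (forall x, psi (x, 0) = 0) ->
    (forall p, closure (fluid_domain eta) p ->
       0 < ext (fluid_domain eta) (dy psi) p) ->
    Rbar_lt
      (Rbar_minus (Lub_Rbar (values eta)) (Glb_Rbar (values eta)))
      (Finite (2 * g / omega ^ 2)).
Proof.
  intros g omega eta psi m Q Hg Hom Heta Hpos Hpsi Hlap HQ Htop Hbot Huni.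
  assert (Hder : forall x, ex_derive eta x) by apply Heta.
  assert (Hcont : forall x, continuous eta x).
  { intros x. apply (ex_derive_continuous eta), Hder. }
  destruct (proj2 Hpsi) as [_ [_ [[[Fx [HFx HFxe]] _] [[Fy [HFy HFye]] _]]]].
  assert (Hcl : forall x y, 0 <= y <= eta x -> closure (fluid_domain eta) (x, y)).
  { intros x y. apply fluid_domain_closure, Hpos. }
  assert (Hsurf : forall x, 0 <= eta x <= eta x) by (intros x; specialize (Hpos x); lra).
  assert (HFyp : forall x y, 0 <= y <= eta x -> 0 < Fy (x, y)).
  { intros x y Hy. rewrite <- (ext_eq _ (dy psi) Fy _ HFy HFye (Hcl x y Hy)).
    apply Huni, Hcl, Hy. }
  assert (HB : bernoulli g Q eta (fun x y => Fx (x, clamp eta x y))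
                 (fun x y => Fy (x, clamp eta x y))).
  { intros x. rewrite !clamp_id by apply Hsurf.
    rewrite <- (ext_eq _ (dx psi) Fx _ HFx HFxe (Hcl x _ (Hsurf x))).
    rewrite <- (ext_eq _ (dy psi) Fy _ HFy HFye (Hcl x _ (Hsurf x))).
    apply HQ. }
  assert (Hflow := fluid_domain_flow omega m eta psi Fx Fy Hpos Hcont Hpsi HFx HFxe HFy HFye
                     Hlap Htop Hbot HFyp).
  (* The kinetic term in Bernoulli's law is nonnegative, so [g * eta x <= Q]: the law itself bounds
     the surface from above. *)
  destruct (Lub_values eta (Q / g)) as [c [-> [Hc Hsup]]].
  { intros x. apply Rle_div_r; [assumption|]. specialize (HB x). simpl in HB.
    nra. }
  destruct (Glb_values eta 0) as [i [-> [Hi0 [Hi Hinf]]]].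
  { intros x. apply Rlt_le, Hpos. }
  apply (amplitude_bound g omega m Q eta _ _ _ i c Hflow); auto.
Qed.
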